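(* Let $K$ be a Polish space and let $F:K\to\mathbb{R}$ be a function. Suppose that $K=\bigcup_{i=1}^\infty W^i$, where each $W^i$ is an ambiguous subset of $K$. If the restriction $F|_{W^i}$ is continuous (on $W^i$ with the relative topology) for every $i\in\mathbb{N}$, then $F$ is pointwise stabilizing, i.e. $F\in \mathrm{PS}(K)$.
   Context: A subset of $K$ is ambiguous if it is both an $F_\sigma$ and a $G_\delta$ subset of $K$. $C(K)$ is the class of continuous functions $K\to\mathbb{R}$. $\mathrm{PS}(K)$, the class of pointwise stabilizing functions, is the set of all $f:K\to\mathbb{R}$ for which there is a sequence $(f_n)\subset C(K)$ such that for every $k\in K$ there is an integer $m$ with $f_n(k)=f(k)$ for all $n\ge m$. *)

(* Defs.v *)
From HB Require Import structures.
From mathcomp Require Import all_boot all_order all_algebra.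
From mathcomp Require Import boolp classical_sets functions cardinality reals.
From mathcomp Require Import topology normedtype sequences borel_hierarchy.

Set Implicit Arguments.
Unset Strict Implicit.
Unset Printing Implicit Defensive.

Import Order.TTheory GRing.Theory Num.Theory.
Import numFieldNormedType.Exports.

Local Open Scope classical_set_scope.
Local Open Scope ring_scope.

Definition separable_space (T : topologicalType) : Prop :=
  exists2 D : set T, countable D & dense D.

(* The library's [completeType] is pointed, which would exclude the empty
   space, hence this property of an arbitrary metric space. *)
Definition complete_metric (R : realType) (M : metricType R) : Prop :=
  forall u : nat -> M, cauchy (u @ \oo) -> exists l : M, u @ \oo --> l.

Definition homeomorphic (S T : topologicalType) : Prop :=
  exists (f : S -> T) (g : T -> S),
    [/\ cancel f g, cancel g f, continuous f & continuous g].

(* Polishness is a property of the topology alone: only the existence of a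
   suitable metric, with values in the reals [R], is required. *)
Definition polish_space (R : realType) (T : topologicalType) : Prop :=
  separable_space T /\
  exists2 M : metricType R, complete_metric M & homeomorphic T M.

Definition ambiguous (T : topologicalType) (A : set T) : Prop :=
  Fsigma A /\ Gdelta A.

Definition PS (R : realType) (T : topologicalType) : set (T -> R) :=
  [set f | exists2 f_ : nat -> T -> R, (forall n, continuous (f_ n)) &
     forall k, exists m : nat, forall n, (m <= n)%N -> f_ n k = f k].
Arguments PS : clear implicits.

(* Main.v *)
Require Import Defs.
From HB Require Import structures.
From mathcomp Require Import all_boot all_order all_algebra.
From mathcomp Require Import boolp classical_sets functions cardinality reals.
From mathcomp Require Import topology normedtype sequences borel_hierarchy.
From mathcomp Require Import numfun.

Import Order.TTheory GRing.Theory Num.Theory.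
Import numFieldNormedType.Exports.

Local Open Scope classical_set_scope.
Local Open Scope ring_scope.

(** Each [W i] is a countable union of closed sets, so [K] is covered by
    countably many closed sets [C i j] on each of which [F] is continuous.
    Let [B n] be the set of the points of the finite union of the [C i j],
    [i, j < n], at which [`|F| <= n + 1].  By the pasting lemma for closed sets,
    [F] is continuous on that union, so [B n] is closed and [F] is continuous
    and bounded on [B n].  The space [K] is metrizable, hence normal, and
    Tietze's theorem ([continuous_bounded_extension]) extends the restriction
    of [F] to [B n] to a continuous function [f_ n] on [K].  Since the [B n]
    increase to [K], every point [k] lies in all [B n] from some rank on, and
    there [f_ n k = F k].

    The pasting lemma does not need the pieces to be disjoint, because [F] is
    defined on the whole of [K]. *)

Lemma homeomorphic_normal (R : realType) (S T : topologicalType) :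
  homeomorphic S T -> normal_space T -> normal_space S.
Proof.
move=> [f [g [fK gK cf cg]]] /(@normal_openP R) nT.
apply/(@normal_openP R) => A B clA clB AB0.
have clgA : closed (g @^-1` A) by exact: preimage_closed.
have clgB : closed (g @^-1` B) by exact: preimage_closed.
have [|U [V [oU oV AU BV UV0]]] := nT _ _ clgA clgB.
  by rewrite -preimage_setI AB0 preimage_set0.
exists (f @^-1` U), (f @^-1` V); split.
- by move/continuousP : cf; exact.
- by move/continuousP : cf; exact.
- by move=> x Ax; apply: AU; rewrite /preimage/= fK.
- by move=> x Bx; apply: BV; rewrite /preimage/= fK.
- by rewrite -preimage_setI UV0 preimage_set0.
Qed.

(** Pasting lemma for a finite family of closed sets. *)
Lemma within_bigsetU_continuous (T U : topologicalType) (I : Type)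
    (s : seq I) (A : I -> set T) (f : T -> U) :
  (forall i, closed (A i)) -> (forall i, {within A i, continuous f}) ->
  {within \big[setU/set0]_(i <- s) A i, continuous f}.
Proof.
move=> clA cf.
suff [] : closed (\big[setU/set0]_(i <- s) A i) /\
          {within \big[setU/set0]_(i <- s) A i, continuous f} by [].
elim/big_ind : _ => //.
- by split; [exact: closed0|exact: continuous_subspace0].
- move=> B C [clB cB] [clC cC].
  by split; [exact: closedU|exact: withinU_continuous].
Qed.

(** The construction of the approximating sequence, on any normal space. *)
Lemma Fsigma_cover_PS (R : realType) (K : topologicalType) (F : K -> R)
    (W : nat -> set K) :
  normal_space K ->
  \bigcup_i W i = [set: K] ->
  (forall i, Fsigma (W i)) ->
  (forall i, {within W i, continuous F}) ->
  PS R K F.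
Proof.
move=> nK WT WF cF.
have /choice[C CW] : forall i, exists C : nat -> set K,
    (forall j, closed (C j)) /\ W i = \bigcup_j C j.
  by move=> i; have [C ? ?] := WF i; exists C.
pose A n := \big[setU/set0]_(p : 'I_n * 'I_n) C p.1 p.2.
have clA n : closed (A n) by apply: closed_bigsetU => p _; exact: (CW _).1.
have cA n : {within A n, continuous F}.
  apply: within_bigsetU_continuous => p; first exact: (CW _).1.
  apply: continuous_subspaceW (cF p.1).
  by rewrite (CW p.1).2 => x Cx; exists p.2.
(* Tietze's theorem requires a positive bound, hence [n.+1] rather than [n]. *)
pose B n := A n `&` F @^-1` [set y | `|y| <= n.+1%:R].
have clB n : closed (B n).
  (* [A n] is closed, so it is enough to be closed in the subspace [A n]. *)
  rewrite /B closed_setSI//; apply: preimage_closed => [x _|]; first exact: cA.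
  rewrite [mkset _](_ : _ = Num.norm @^-1` [set y : R | y <= n.+1%:R])//.
  apply: preimage_closed => [y _|]; last exact: closed_le.
  exact: (@norm_continuous R R^o).
have cB n : {within B n, continuous F}.
  by apply: continuous_subspaceW (cA n) => x [].
have /choice[f_ f_P] : forall n, exists g : K -> R,
    continuous g /\ {in B n, F =1 g}.
  move=> n.
  have [||x []//|g [Fg cg _]] :=
      @continuous_bounded_extension K R nK (B n) (clB n) F n.+1%:R.
  - exact: ltr0Sn.
  - exact: cB.
  by exists g.
exists f_ => [n|k]; first exact: (f_P n).1.
have [i _] : (\bigcup_i W i) k by rewrite WT.
rewrite (CW i).2 => -[j _ Cijk].
exists (maxn (maxn i j).+1 (Num.bound `|F k|)) => n.
rewrite geq_max gtn_max -andbA => /and3P[ltin ltjn Fkn].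
apply/esym/(f_P n).2/mem_set; split.
  rewrite /A -bigcup_seq; exists (Ordinal ltin, Ordinal ltjn) => //=.
  exact: mem_index_enum.
rewrite /preimage/= ltW// (lt_le_trans (archi_boundP (normr_ge0 _)))//.
by rewrite ler_nat (leq_trans Fkn).
Qed.

Theorem theorem3p1 (R : realType) (K : topologicalType) (F : K -> R)
    (W : nat -> set K) :
  polish_space R K ->
  \bigcup_i W i = [set: K] ->
  (forall i, ambiguous (W i)) ->
  (forall i, {within W i, continuous F}) ->
  PS R K F.
Proof.
move=> [_ [M _ KM]] WT WF cF.
apply: (@Fsigma_cover_PS _ _ _ W) => // [|i]; last exact: (WF i).1.
exact: homeomorphic_normal R _ _ KM (@pseudometric_normal R M).
Qed.
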